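(* Let $\rho$ be a calibration function and set $u_k = \lfloor \rho^{-1}(k)\rfloor$ for integers $k \ge 0$. Let $T\colon X\to X$ be a continuous linear operator on a separable infinite-dimensional Fréchet space $X$. Suppose that there exist a dense subset $X_0\subset X$ and a map $S\colon X_0\to X_0$ such that, for each $x\in X_0$, the following hold: (i) $\sum_{j=1}^{k} T^{u_k-u_{k-j}}x$ converges unconditionally, uniformly in $k\in\mathbb{N}$; (ii) $\sum_{j=1}^{\infty} S^{u_{j+k}-u_k}(x)$ converges unconditionally, uniformly in $k\in\mathbb{N}$; (iii) $TS(x)=x$. Then the operator $T$ is $\rho$-frequently hypercyclic.
   Context: $\mathbb{N}=\{1,2,3,\dots\}$. A calibration function is a function $\rho\colon[0,\infty)\to[0,\infty)$ such that: (1) $\rho$ is continuous, strictly increasing and unbounded; (2) $|\rho(t_1)-\rho(t_2)|\le|t_1-t_2|$ for all $t_1,t_2\ge0$; (3) $\rho$ is concave; (4) $\rho(t)/t$ is a non-increasing function of $t>0$; normalized so that $\rho(0)=0$. (Only the behaviour of $\rho$ for large $t$ matters, and functions having these properties only for large $t$ are regarded as calibration functions after modification for small $t$.) In particular $u_0=0$. The lower $\rho$-density of $\mathcal{A}\subseteq\mathbb{N}$ is $\liminf_{N\to\infty}\frac{\#\{n\in\mathcal{A}: n\le N\}}{\rho(N)}\in[0,\infty]$. A continuous linear operator $T$ on a separable infinite-dimensional Fréchet space $X$ is $\rho$-frequently hypercyclic if there is $x\in X$ such that, for each nonempty open $U\subset X$, the return set $\{n\in\mathbb{N}: T^nx\in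 U\}$ has positive lower $\rho$-density. An $F$-norm on $X$ is a functional $\|\cdot\|\colon X\to[0,\infty)$ such that for all $x,y\in X$ and scalars $\lambda$: $\|x+y\|\le\|x\|+\|y\|$; $\|\lambda x\|\le\|x\|$ if $|\lambda|\le1$; $\lim_{\lambda\to0}\|\lambda x\|=0$; $\|x\|=0$ implies $x=0$. Let $\|\cdot\|$ be an $F$-norm inducing the (complete) topology of $X$. A collection of series $\sum_{j=1}^\infty x_{\lambda,j}$, $\lambda\in\Lambda$, in $X$ converges unconditionally, uniformly in $\lambda\in\Lambda$, if for every $\varepsilon>0$ there is $N\ge1$ such that for every finite set $F\subset\mathbb{N}$ with $F\cap\{1,\dots,N\}=\varnothing$ and every $\lambda\in\Lambda$ we have $\|\sum_{j\in F}x_{\lambda,j}\|<\varepsilon$. A finite sum $\sum_{j=1}^k$ is regarded as a series whose terms with $j>k$ are $0$. *)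

(* Defs.v *)
From HB Require Import structures.
From mathcomp Require Import all_boot all_order all_algebra.
From mathcomp Require Import finmap complex.
From mathcomp Require Import all_classical all_reals all_analysis.

Set Implicit Arguments.
Unset Strict Implicit.
Unset Printing Implicit Defensive.

Import Order.TTheory GRing.Theory Num.Theory.
Import numFieldNormedType.Exports.

Local Open Scope classical_set_scope.
Local Open Scope ring_scope.

(* Calibration functions. A function on [0,+oo[ is represented by a total
   function on R, of which only the restriction to [0,+oo[ is ever used. *)
Record calibration (R : realType) (rho : R -> R) : Prop := Calibration {
  calibration_ge0 : forall t : R, 0 <= t -> 0 <= rho t ;
  calibration0 : rho 0 = 0 ;
  calibration_continuous : {within `[0, +oo[, continuous rho} ;
  calibration_increasing : {in `[0, +oo[ &, {homo rho : s t / s < t}} ;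
  calibration_unbounded : forall M : R, exists2 t : R, 0 <= t & M < rho t ;
  calibration_lipschitz :
    {in `[0, +oo[ &, forall s t, `|rho s - rho t| <= `|s - t|} ;
  calibration_concave : convex_function (E := R^o) `[0, +oo[ (\- rho) ;
  calibration_ratio :
    {in `]0, +oo[ &, forall s t, s <= t -> rho t / t <= rho s / s} }.

(* u_k = floor (rho^-1 k). When rho is a calibration function, it is a
   bijection of [0,+oo[, so the default value of the inverse is irrelevant and
   the truncation is the floor of a nonnegative number. *)
Definition calib_seq (R : realType) (rho : R -> R) (k : nat) : nat :=
  Num.truncn ('pinv_(fun=> 0) `[0, +oo[ rho k%:R).

(* The term of index N = 0, which is spurious, does not affect the liminf. *)
Definition lower_density (R : realType) (rho : R -> R) (A : set nat) : \bar R :=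
  limn_einf (fun N =>
    ((\sum_(1 <= n < N.+1 | n \in A) 1)%N%:R / rho N%:R)%:E).

Definition freq_hypercyclic (R : realType) (rho : R -> R)
    (X : topologicalType) (T : X -> X) : Prop :=
  exists x : X, forall U : set X, open U -> U !=set0 ->
    (0%:E < lower_density rho [set n | U (iter n T x)])%E.

Variant real_or_complex (R : realType) : numFieldType -> Prop :=
| RealScalars : real_or_complex R R
| ComplexScalars : real_or_complex R R[i].

Definition induces_topology (R : realType) (X : topologicalType)
    (d : X -> X -> R) : Prop :=
  forall x,
    nbhs x = filter_from [set e : R | 0 < e] (fun e : R => [set y | d x y < e]).

(* The uniform structure carried by a tvsType is only required to induce its
   topology, not to be translation invariant; completeness is therefore stated
   with an invariant metric. Local convexity is part of tvsType. *)
Definition frechet (R : realType) (K : numFieldType) (X : tvsType K) : Prop :=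
  exists d : X -> X -> R,
    [/\ [/\ forall x y, d x y = 0 <-> x = y,
            forall x y, d x y = d y x &
            forall x y z, d x z <= d x y + d y z],
        forall x y z, d (x + z) (y + z) = d x y,
        induces_topology d &
        forall u : nat -> X,
          (forall e : R, 0 < e ->
             exists N, forall m n, (N <= m)%N -> (N <= n)%N ->
               d (u m) (u n) < e) ->
          exists l : X, u @ \oo --> l].

Definition separable (X : topologicalType) : Prop :=
  exists2 D : set X, countable D & dense D.

Definition infinite_dimensional (K : fieldType) (X : lmodType K) : Prop :=
  ~ exists n (v : 'I_n -> X),
      forall x, exists c : 'I_n -> K, x = \sum_(i < n) c i *: v i.

Record Fnorm (R : realType) (K : numFieldType) (X : lmodType K)
    (nrm : X -> R) : Prop := IsFnorm {
  Fnorm_ge0 : forall x, 0 <= nrm x ;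
  Fnorm_triangle : forall x y, nrm (x + y) <= nrm x + nrm y ;
  Fnorm_scale : forall (l : K) x, `|l| <= 1 -> nrm (l *: x) <= nrm x ;
  Fnorm_lim0 : forall x, nrm (l *: x) @[l --> (0 : K)] --> (0 : R) ;
  Fnorm_eq0 : forall x, nrm x = 0 -> x = 0 }.

(* The series are indexed by j >= 1: the term x i 0 is ignored. *)
Definition unconditional_cvg_uniformly (R : realType) (X : zmodType)
    (nrm : X -> R) (I : Type) (L : set I) (x : I -> nat -> X) : Prop :=
  forall e : R, 0 < e -> exists2 N, (1 <= N)%N &
    forall F : {fset nat}, (forall j, j \in F -> (N < j)%N) ->
      forall i, L i -> nrm (\sum_(j <- F) x i j) < e.

(* Main.v *)
Require Import Defs.
From HB Require Import structures.
From mathcomp Require Import all_boot all_order all_algebra.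
From mathcomp Require Import finmap complex.
From mathcomp Require Import all_classical all_reals all_analysis.
From mathcomp Require Import zify ring lra.

(** Write v(i) for the 2-adic valuation of i.  The hypercyclic vector is an
    explicit series
      x = sum over i >= 1 of S^(u_(p i) - u_1) y_(c (v i)),
    where (y_l) is a sequence of points of X0 that is dense in X, where
    1 = p 0 < p 1 < p 2 < ... are positions among the indices of (u_k), and
    where c assigns a point y_l to each valuation.  Since T S = id on X0,
    applying T^(u_n - u_1) with n = p j turns the i-th term into
    T^(u_n - u_k) y if k = p i is below n, and into S^(u_k - u_n) y if k is
    above n; the term i = j becomes y_(c (v j)) itself.  Hypothesis (i)
    controls the first kind of terms and (ii) the second kind, both uniformly
    in n, provided that all the k involved are far from n
    ([shifted_term_tails]).  Hence T^(u_n - u_1) x is close to y_(c (v j)) as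
    soon as n = p j is far from all other positions.

    For this to work for all y_l at once, positions that carry y_l must keep a
    distance N_l, prescribed by y_l, from all the others
    ([uniformly_small_tails_colored]); for the return sets to be large, the
    positions must have positive density.  The 2-adic valuation reconciles the
    two demands.  Since v(1) + ... + v(n) = v(n!) <= n, one can isolate p i by
    v(i) on both sides and still have p i = O(i) ([ruler_positions]); and c
    can be chosen so slow that N_(c (v i)) never exceeds v(i) by more than a
    constant, while every l is taken at arbitrarily large valuations
    ([slow_recurrent_coloring]).  Given a nonempty open set U, pick y_l in U
    and a large v with c v = l: all j with v(j) = v, which are the numbers
    2^v (2 i + 1), give return times u_(p j) - u_1 to U.  As
    rho (u_(p j)) <= p j = O(j), these return times alone have positive lower
    rho-density ([lower_density_gt0]). *)

Set Implicit Arguments.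
Unset Strict Implicit.
Unset Printing Implicit Defensive.

Import Order.TTheory GRing.Theory Num.Theory.
Import numFieldNormedType.Exports.

Local Open Scope classical_set_scope.
Local Open Scope ring_scope.

(** * Isolated positions of positive density *)

(** The sum is the 2-adic valuation of n!, given by Legendre's formula; the
    claim is then that n/2 + n/4 + n/8 + ... stays below n. *)
Lemma sum_logn2_le n : (\sum_(i < n.+1) logn 2 i <= n)%N.
Proof.
have -> : (\sum_(i < n.+1) logn 2 i = logn 2 n`!)%N.
  elim: n => [|n IH]; first by rewrite big_ord1.
  by rewrite big_ord_recr /= IH factS lognM ?fact_gt0 // addnC.
rewrite logn_fact //.
(* The last term of the partial sum is added once more: this is the
   strengthening that makes the geometric bound inductive. *)
suff H m : (\sum_(1 <= k < m.+1) n %/ 2 ^ k + n %/ 2 ^ m <= n)%N.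
  exact: leq_trans (leq_addr _ _) (H n).
elim: m => [|m IH]; first by rewrite big_geq // expn0 divn1.
rewrite big_nat_recr //= -addnA; apply: leq_trans IH; rewrite leq_add2l.
by rewrite addnn -mul2n expnSr divnMA mulnC leq_divM.
Qed.

(** The increment p (i + 1) - p i is the sum of the radii of isolation wanted
    around both ends.  These radii grow like the valuation, which is bounded
    on average, so that the positions grow at most linearly. *)
Lemma ruler_positions B : exists p : nat -> nat,
  [/\ p 0 = 1,
      forall i j, (i < j)%N -> (p i + maxn (logn 2 i) (logn 2 j) + B < p j)%N &
      exists C, forall i, (p i <= C * i.+1)%N].
Proof.
pose w i := (logn 2 i + B).+1.
pose p i := (1 + \sum_(j < i) (w j + w j.+1))%N.
have pS i : p i.+1 = (p i + (w i + w i.+1))%N.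
  by rewrite /p big_ord_recr /= addnA.
have pw i d : (p i + maxn (w i) (w (i + d).+1) <= p (i + d).+1)%N.
  clearbody p; clearbody w.
  elim: d => [|d IH]; first by rewrite addn0 pS; lia.
  by rewrite addnS pS; move: IH; lia.
exists p; split.
- by rewrite /p big_ord0.
- move=> i j /subnKC <-; have := pw i (j - i.+1)%N.
  by rewrite addSn /w; lia.
- exists (2 * B + 5)%N => i.
  have le2 : (p i <= 1 + 2 * \sum_(j < i.+1) w j)%N.
    rewrite /p big_split leq_add2l mul2n -addnn leq_add //.
      by rewrite big_ord_recr /= leq_addr.
    by rewrite [leqRHS]big_ord_recl leq_addl.
  have : (\sum_(j < i.+1) w j <= i + i.+1 * B.+1)%N.
    under eq_bigr do rewrite /w -addnS.
    by rewrite big_split /= sum_nat_const card_ord leq_add2r sum_logn2_le.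
  by move: le2; lia.
Qed.

(** Any map that takes every value infinitely often can be slowed down by
    sending to the colour 0 those v at which N is still too large; this
    discards only finitely many occurrences of each colour. *)
Lemma slow_recurrent_coloring (N : nat -> nat) : exists c : nat -> nat,
  (forall v, (N (c v) <= v + N 0)%N) /\
  (forall l m, exists2 v, (m < v)%N & c v = l).
Proof.
pose c0 v := logn 2 v.+1.
exists (fun v => if (N (c0 v) <= v)%N then c0 v else 0%N); split.
  by move=> v; case: ifP => [/leq_trans->|]; rewrite ?leq_addr ?leq_addl.
move=> l m; pose q := (2 ^ l * (m + N l).+1.*2.+1)%N.
have q_gt : (m + N l + 1 < q)%N.
  by rewrite /q; have := expn_gt0 2 l; nia.
exists q.-1; first by lia.
have -> : c0 q.-1 = l.
  rewrite /c0 prednK; last exact: leq_ltn_trans q_gt.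
  by rewrite /q lognM ?expn_gt0 // pfactorK // lognE dvdn2 /= odd_double addn0.
by case: ifP => //; lia.
Qed.

(** * Lower density and the sequence of a calibration function *)

Lemma limn_einf_ge (R : realType) (a : (\bar R)^nat) (c : \bar R) (m : nat) :
  (forall n, (m <= n)%N -> (c <= a n)%E) -> (c <= limn_einf a)%E.
Proof.
move=> ca; rewrite limn_einf_lim (cvg_lim _ (@cvg_einfs_sup _ _)) //.
apply: (@le_trans _ _ (einfs a m)); last by apply: ereal_sup_ubound; exists m.
by apply: le_ereal_inf_tmp => _ [n /= mn <-]; exact: ca.
Qed.

(** If rho (t j) is at most C (j + 1), the times t j that are at most n
    include all those with C (j + 1) <= rho n, which are about rho n / C many.
    As rho is unbounded, rounding costs at most half of them. *)
Lemma lower_density_gt0 (R : realType) (rho : R -> R) (hrho : calibration rho)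
    (A : set nat) (t : nat -> nat) (C : nat) :
    injective t -> (forall j, (0 < t j)%N) -> (forall j, A (t j)) ->
    (forall j, rho (t j)%:R <= (C * j.+1)%:R) ->
  (0%:E < lower_density rho A)%E.
Proof.
move=> t_inj t_gt0 At rho_t.
have rho_lt x y : 0 <= x -> x < y -> rho x < rho y.
  move=> x0 xy; apply: (calibration_increasing hrho) => //;
    rewrite in_itv /= andbT //; exact/ltW/(le_lt_trans x0).
have C_gt0 : (0 < C)%N.
  rewrite lt0n; apply/eqP => C0; have := rho_t 0%N.
  by rewrite C0 mul0n mulr0n leNgt -[ltLHS](calibration0 hrho) rho_lt ?ltr0n.
have [x0 x0_ge0 x0_gt] := calibration_unbounded hrho (2 * C%:R).
pose d : R := (2 * C%:R)^-1.
have d_gt0 : 0 < d by rewrite invr_gt0 mulr_gt0 // ltr0n.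
apply: (@lt_le_trans _ _ d%:E); first by rewrite lte_fin.
apply: (@limn_einf_ge _ _ _ (Num.truncn x0).+1) => n n_big.
rewrite lee_fin.
have x0n : x0 < n%:R.
  by apply: lt_le_trans (truncnS_gt _) _; rewrite ler_nat.
have rho_n : 2 * C%:R < rho n%:R by apply: lt_trans x0_gt (rho_lt _ _ _ _).
have C_gt0R : 0 < C%:R :> R by rewrite ltr0n.
have rho_n_gt0 : 0 < rho n%:R by apply: lt_trans rho_n; rewrite mulr_gt0.
rewrite ler_pdivlMr //.
pose m := Num.truncn (rho n%:R / C%:R).
have m_ge : d * rho n%:R <= m%:R.
  have := truncnS_gt (rho n%:R / C%:R); rewrite -/m -natr1.
  have : 1 < d * rho n%:R by rewrite /d mulrC ltr_pdivlMr ?mul1r// mulr_gt0.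
  have -> : rho n%:R / C%:R = 2 * (d * rho n%:R).
    by rewrite /d; field; rewrite lt0r_neq0.
  by lra.
apply: le_trans m_ge _; rewrite ler_nat.
rewrite -big_filter sum1_size -(size_iota 0 m) -(size_map t).
apply: uniq_leq_size; first by rewrite map_inj_uniq ?iota_uniq.
move=> x /mapP[j]; rewrite mem_iota add0n => /andP[_ jm] -> {x}.
rewrite mem_filter mem_index_iota t_gt0 ltnS; apply/andP; split.
  by rewrite inE; exact: At.
rewrite leqNgt; apply/negP => ntj.
have : rho n%:R < (C * j.+1)%:R.
  by apply: lt_le_trans (rho_t j); rewrite rho_lt ?ler0n ?ltr_nat.
rewrite natrM mulrC -ltr_pdivrMr // -truncn_le_nat // leqNgt.
by rewrite -/m jm.
Qed.

Lemma calib_inverse (R : realType) (rho : R -> R) (hrho : calibration rho)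
    (k : nat) (r := 'pinv_(fun=> 0) `[0, +oo[ rho k%:R) :
  0 <= r /\ rho r = k%:R.
Proof.
have kim : (k%:R : R) \in rho @` `[0, +oo[%classic.
  have [b b0 kb] := calibration_unbounded hrho k%:R.
  have [] := @IVT R rho 0 b k%:R b0.
  - apply: continuous_subspaceW (calibration_continuous hrho) => x /=.
    by rewrite !in_itv /= => /andP[->].
  - rewrite (calibration0 hrho) ge_min ler0n /= le_max (ltW kb) orbT //.
  move=> x; rewrite in_itv /= => /andP[x0 _] <-; rewrite inE.
  by exists x => //=; rewrite in_itv /= x0.
split; last by rewrite /r pinvK.
have inj : {in `[0, +oo[%classic &, injective rho}.
  move=> x y; rewrite !inE => x0 y0 xy.
  have [xy'|yx'|//] := ltgtP x y.
  - by have := calibration_increasing hrho x0 y0 xy'; rewrite xy ltxx.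
  - by have := calibration_increasing hrho y0 x0 yx'; rewrite xy ltxx.
have := injpinv_image (fun=> 0) inj.
move=> /seteqP[+ _] => /(_ r); rewrite /= in_itv /= andbT; apply.
by exists k%:R => //; move: kim; rewrite inE.
Qed.

(** A 1-Lipschitz function has an expanding inverse, so that consecutive
    values of the inverse at integers differ by at least 1. *)
Lemma calib_seq_lt (R : realType) (rho : R -> R) (hrho : calibration rho) i j :
  (i < j)%N -> (calib_seq rho i < calib_seq rho j)%N.
Proof.
move=> ij; rewrite /calib_seq.
have [si ri] := calib_inverse hrho i; have [sj rj] := calib_inverse hrho j.
set s := 'pinv_(fun=> 0) `[0, +oo[ rho i%:R in si ri *.
set t := 'pinv_(fun=> 0) `[0, +oo[ rho j%:R in sj rj *.
have st : s < t.
  rewrite ltNge; apply/negP; rewrite le_eqVlt => /predU1P[ts|ts].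
    by have := ltr_nat R i j; rewrite -ri -rj ts ltxx ij.
  have : rho t < rho s.
    by apply: (calibration_increasing hrho) => //; rewrite in_itv /= ?si ?sj.
  by rewrite ri rj ltr_nat ltnNge ltnW.
rewrite truncn_ge_nat // -natr1.
apply: (@le_trans _ _ (s + 1)); first by rewrite lerD2r truncn_le.
have : `|rho t - rho s| <= `|t - s|.
  by apply: (calibration_lipschitz hrho); rewrite in_itv /= ?si ?sj.
rewrite ri rj ger0_norm ?subr_ge0 ?ler_nat ?(ltnW ij) //.
rewrite gtr0_norm ?subr_gt0 //.
have : i.+1%:R <= j%:R :> R by rewrite ler_nat.
by rewrite -natr1; lra.
Qed.

Lemma rho_calib_seq_le (R : realType) (rho : R -> R) (hrho : calibration rho)
  (n k : nat) : (n <= calib_seq rho k)%N -> rho n%:R <= k%:R.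
Proof.
have [s0 <-] := calib_inverse hrho k; rewrite /calib_seq.
set s := 'pinv_(fun=> 0) `[0, +oo[ rho k%:R in s0 *.
rewrite truncn_ge_nat // le_eqVlt => /predU1P[->//|ns].
by apply/ltW/(calibration_increasing hrho) => //; rewrite in_itv /= ?ler0n ?s0.
Qed.

(** * F-norms and unconditional convergence *)

Lemma FnormN (R : realType) (K : numFieldType) (X : lmodType K) (nrm : X -> R)
  (hnrm : Fnorm nrm) x : nrm (- x) = nrm x.
Proof.
have le_nrm z : nrm (- z) <= nrm z.
  by rewrite -scaleN1r; apply: (Fnorm_scale hnrm); rewrite normrN1.
by apply/le_anti; rewrite le_nrm -{1}[x]opprK le_nrm.
Qed.

Lemma Fnorm0 (R : realType) (K : numFieldType) (X : lmodType K) (nrm : X -> R)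
  (hnrm : Fnorm nrm) : nrm 0 = 0.
Proof.
have := Fnorm_lim0 hnrm 0; under eq_fun do rewrite scaler0.
by move/(cvg_unique (@norm_hausdorff _ _) (cvg_cst _)).
Qed.

Lemma Fnorm_sum (R : realType) (K : numFieldType) (X : lmodType K)
    (nrm : X -> R) (hnrm : Fnorm nrm) (I : Type) (r : seq I) (P : pred I) F :
  nrm (\sum_(i <- r | P i) F i) <= \sum_(i <- r | P i) nrm (F i).
Proof.
elim/big_ind2: _ => [|x a y b xa yb|//]; first by rewrite (Fnorm0 hnrm).
exact: le_trans (Fnorm_triangle hnrm _ _) (lerD xa yb).
Qed.

Lemma unconditional_cvg_seq (R : realType) (X : zmodType) (nrm : X -> R)
    (I : Type) (L : set I) (x : I -> nat -> X) (e : R) :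
    unconditional_cvg_uniformly nrm L x -> 0 < e ->
  exists N, forall s : seq nat, uniq s -> (forall j, j \in s -> (N < j)%N) ->
    forall i, L i -> nrm (\sum_(j <- s) x i j) < e.
Proof.
move=> cvg_x e_gt0; have [N _ HN] := cvg_x e e_gt0.
exists N => s s_uniq s_gt i Li.
have -> : \sum_(j <- s) x i j = \sum_(j <- [fset j | j in s]%fset) x i j.
  by apply/perm_big/uniq_perm => [||j]; rewrite ?fset_uniq ?inE.
by apply: HN => // j; rewrite !inE; apply: s_gt.
Qed.

(** One of the two truncated differences vanishes: this is |n - k|. *)
Definition gap (n k : nat) := ((n - k) + (k - n))%N.

(** The index n = 0 is left out because the convergence hypotheses of the
    criterion start at k = 1. *)
Definition uniformly_small_tails (R : realType) (X : zmodType) (nrm : X -> R)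
    (f : nat -> nat -> X) (e : R) (N : nat) :=
  forall (n : nat) (s : seq nat), (0 < n)%N -> uniq s ->
    (forall k, k \in s -> (N < gap n k)%N) -> nrm (\sum_(k <- s) f n k) < e.

Lemma sum_geometric_half_lt (R : realType) m (e : R) : 0 < e ->
  \sum_(l < m) e / 2 ^+ l.+1 < e.
Proof.
move=> e_gt0.
have -> : \sum_(l < m) e / 2 ^+ l.+1 = e - e / 2 ^+ m.
  elim: m => [|m IH]; first by rewrite big_ord0 expr0 divr1 subrr.
  rewrite big_ord_recr /= IH exprS; field.
  by rewrite expf_neq0.
by rewrite gtrDl oppr_lt0 divr_gt0 // exprn_gt0.
Qed.

(** Small tails for each of the families f l add up to small tails for a sum
    in which each index i picks the family f (c i).  The terms of colour l
    contribute at most e / 2^(l+1): for the finitely many l below some L this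
    is ensured by the threshold M; for the other l the threshold N l, which is
    independent of e, suffices, because 4^-l <= e / 2^(l+1) when l is large.
    That M does not depend on c, p, n and s is what makes the estimate usable
    at all positions at once. *)
Lemma uniformly_small_tails_colored (R : realType) (K : numFieldType)
    (X : lmodType K) (nrm : X -> R) (hnrm : Fnorm nrm)
    (f : nat -> nat -> nat -> X) (N : nat -> nat)
    (f_tails : forall l (e : R), 0 < e ->
       exists M, uniformly_small_tails nrm (f l) e M)
    (N_tails : forall l,
       uniformly_small_tails nrm (f l) ((2 ^+ l)^-1 ^+ 2) (N l))
    (e : R) (e_gt0 : 0 < e) :
  exists M, forall c p : nat -> nat, injective p ->
    forall (n : nat) (s : seq nat), (0 < n)%N -> uniq s ->
      (forall i, i \in s -> (maxn M (N (c i)) < gap n (p i))%N) ->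
      nrm (\sum_(i <- s) f (c i) n (p i)) < e.
Proof.
have pow_gt0 l : 0 < (2 : R) ^+ l by rewrite exprn_gt0.
have e_pow_gt0 l : 0 < e / 2 ^+ l.+1 by rewrite divr_gt0.
have [M0 HM0] := choice (fun l => f_tails l _ (e_pow_gt0 l)).
(* From L on, 2 / e <= 2 ^ l, that is, 4 ^ - l <= e / 2 ^ (l + 1). *)
pose L := (Num.truncn (2 / e)).+1.
exists (\max_(l < L) M0 l)%N => c p p_inj n s n_gt0 s_uniq s_gap.
pose m := (\max_(i <- s) c i)%N.
have inord_c i : i \in s -> (inord (c i) : 'I_m.+1) = c i :> nat.
  move=> si; rewrite inordK // ltnS.
  exact: (@leq_bigmax_seq _ s xpredT c i si).
rewrite (partition_big (fun i => inord (c i) : 'I_m.+1) xpredT) //=.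
apply: le_lt_trans (Fnorm_sum hnrm _ _ _) _.
apply: le_lt_trans (sum_geometric_half_lt m.+1 e_gt0).
apply: ler_sum => l _; rewrite -big_filter; set s' := seq.filter _ s.
have s'P i : i \in s' -> i \in s /\ c i = l.
  by rewrite mem_filter => /andP[/eqP <- si]; rewrite inord_c.
have -> : \sum_(i <- s') f (c i) n (p i) = \sum_(k <- map p s') f l n k.
  by rewrite big_map; apply: eq_big_seq => i /s'P[_ ->].
have ps'_uniq : uniq (map p s') by rewrite map_inj_uniq // filter_uniq.
have ps'_gap k : k \in map p s' ->
    (maxn (\max_(l < L) M0 l) (N l) < gap n k)%N.
  by move=> /mapP[i /s'P[si <-] ->]; exact: s_gap.
have [lL|Ll] := ltnP l L.
  apply/ltW/HM0 => // k /ps'_gap; apply: leq_ltn_trans.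
  by rewrite leq_max (leq_bigmax (Ordinal lL)).
apply: le_trans (ltW (N_tails l n _ n_gt0 ps'_uniq _)) _.
  by move=> k /ps'_gap; apply: leq_ltn_trans; rewrite leq_maxr.
rewrite expr2 exprSr invfM [e * _]mulrCA ler_pM2l ?invr_gt0 //.
rewrite -[e]invrK -invfM lef_pV2 ?posrE ?mulr_gt0 ?invr_gt0 //.
rewrite mulrC -/(2 / e).
apply: le_trans (ltW (truncnS_gt _)) _; rewrite -/L.
by rewrite -natrX ler_nat (leq_trans Ll) // ltnW // ltn_expl.
Qed.

(** * Two-sided sums along the orbit *)

Section TwoSidedSums.
Context (R : realType) (K : numFieldType) (X : tvsType K) (nrm : X -> R).
Context (T : {linear X -> X}) (X0 : set X) (S : X -> X).
Hypotheses (hnrm : Fnorm nrm) (hS : set_fun X0 X0 S).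
Hypothesis (TS : forall x, X0 x -> T (S x) = x).

Lemma iter_sum n (I : Type) (r : seq I) (P : pred I) (F : I -> X) :
  iter n T (\sum_(i <- r | P i) F i) = \sum_(i <- r | P i) iter n T (F i).
Proof. by elim: n => //= n ->; rewrite linear_sum. Qed.

Lemma iter_cancel a b y : X0 y ->
  iter a T (iter b S y) = iter (a - b) T (iter (b - a) S y).
Proof.
move=> yX0; elim: a b => [|a IH] [|b]; rewrite ?subn0 ?sub0n //.
by rewrite iterSr /= TS ?IH ?subSS //; elim: b => //= b; exact: hS.
Qed.

Context (u : nat -> nat) (u_lt : {homo u : i j / (i < j)%N}).

(** The truncated subtractions merge the two regimes of the criterion: this is
    T^(u_n - u_k) y for k <= n and S^(u_k - u_n) y for k >= n. *)
Definition shifted_term y n k := iter (u n - u k) T (iter (u k - u n) S y).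

Lemma shifted_term_id y n : shifted_term y n n = y.
Proof. by rewrite /shifted_term subnn. Qed.

Lemma iter_shifted_term y m n k : X0 y -> (u m <= u n)%N -> (u m <= u k)%N ->
  iter (u n - u m) T (shifted_term y m k) = shifted_term y n k.
Proof.
move=> yX0 mn mk; rewrite /shifted_term; move: (mk); rewrite -subn_eq0.
move=> /eqP -> /=; rewrite iter_cancel //; congr (iter _ T (iter _ S y)); lia.
Qed.

(** Hypothesis (i), with j = n - k, bounds the part of the sum below n, and
    hypothesis (ii), with j = k - n, the part above n. *)
Lemma shifted_term_tails y
    (h1 : unconditional_cvg_uniformly nrm [set k | (1 <= k)%N]
       (fun k j => if (j <= k)%N then iter (u k - u (k - j))%N T y else 0))
    (h2 : unconditional_cvg_uniformly nrm [set k | (1 <= k)%N]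
       (fun k j => iter (u (j + k) - u k)%N S y)) (e : R) :
  0 < e -> exists N, uniformly_small_tails nrm (shifted_term y) e N.
Proof.
move=> e_gt0; have e2_gt0 : 0 < e / 2 by rewrite divr_gt0.
have [N1 H1] := unconditional_cvg_seq h1 e2_gt0.
have [N2 H2] := unconditional_cvg_seq h2 e2_gt0.
have u_le i j : (i <= j)%N -> (u i <= u j)%N.
  by rewrite leq_eqVlt => /predU1P[->//|/u_lt/ltnW].
exists (maxn N1 N2) => n s n_gt0 s_uniq s_gap.
rewrite (bigID (fun k => k < n)%N) /=.
apply: le_lt_trans (Fnorm_triangle hnrm _ _) _; rewrite (splitr e).
rewrite -big_filter -[X in _ + nrm X]big_filter.
set lo := seq.filter _ s; set hi := seq.filter _ s.
have loP k : k \in lo -> (k < n)%N /\ (maxn N1 N2 < n - k)%N.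
  rewrite mem_filter => /andP[kn /s_gap]; rewrite /gap; lia.
have hiP k : k \in hi -> (n <= k)%N /\ (maxn N1 N2 < k - n)%N.
  rewrite mem_filter -leqNgt => /andP[nk /s_gap]; rewrite /gap; lia.
apply: ltrD.
- rewrite (eq_big_seq (fun k => if (n - k <= n)%N then
      iter (u n - u (n - (n - k)))%N T y else 0)); last first.
    move=> k /loP[/ltnW kn _]; rewrite leq_subr subKn // /shifted_term.
    by have /eqP -> : (u k - u n == 0)%N by rewrite subn_eq0 u_le.
  rewrite -(big_map (fun k => n - k)%N xpredT (fun j => if (j <= n)%N then
      iter (u n - u (n - j))%N T y else 0)).
  apply: H1 => //.
    rewrite map_inj_in_uniq ?filter_uniq // => i j /loP[? _] /loP[? _]; lia.
  by move=> _ /mapP[k /loP[_ +] ->]; lia.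
- rewrite (eq_big_seq (fun k => iter (u (k - n + n) - u n)%N S y)); last first.
    move=> k /hiP[nk _]; rewrite subnK // /shifted_term.
    by have /eqP -> : (u n - u k == 0)%N by rewrite subn_eq0 u_le.
  rewrite -(big_map (fun k => k - n)%N xpredT
      (fun j => iter (u (j + n) - u n)%N S y)).
  apply: H2 => //.
    rewrite map_inj_in_uniq ?filter_uniq // => i j /hiP[? _] /hiP[? _]; lia.
  by move=> _ /mapP[k /hiP[_ +] ->]; lia.
Qed.

End TwoSidedSums.

(** * Completeness and separability *)

(** Completeness is given for some invariant metric d.  Two invariant metrics
    with the same topology have the same Cauchy sequences, since they have the
    same neighbourhoods of 0. *)
Lemma Fnorm_complete (R : realType) (K : numFieldType) (X : tvsType K)
    (hX : frechet R X) (nrm : X -> R) (hnrm : Fnorm nrm)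
    (htop : induces_topology (fun x y => nrm (x - y))) (x : nat -> X) :
    (forall e, 0 < e -> exists M, forall m n, (M <= m)%N -> (m <= n)%N ->
       nrm (x n - x m) < e) ->
  exists l : X, x @ \oo --> l.
Proof.
move=> x_cauchy; have [d [[_ d_sym _] d_inv d_top d_complete]] := hX.
apply: d_complete => e e_gt0.
have : nbhs (0 : X) [set z | d 0 z < e] by rewrite d_top; exists e.
rewrite htop => -[r /= r_gt0 nrm_d].
have [M HM] := x_cauchy r r_gt0; exists M.
have H m n : (M <= m)%N -> (m <= n)%N -> d (x m) (x n) < e.
  move=> Mm mn; rewrite -[x m]add0r -(subrK (x m) (x n)) d_inv.
  by apply: nrm_d; rewrite /= sub0r (FnormN hnrm) HM.
move=> m n Mm Mn; have [mn|/ltnW nm] := leqP m n; first exact: H.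
by rewrite d_sym H.
Qed.

Lemma dense_nbhs (X : topologicalType) (A : set X) (x : X) (V : set X) :
  dense A -> nbhs x V -> exists2 z, A z & V z.
Proof.
move=> dA; rewrite nbhsE => -[U [oU Ux] UV].
have [z [Uz Az]] := dA U (ex_intro _ x Ux) oU.
by exists z => //; exact: UV.
Qed.

(** A subset of a separable metric space is separable: approximate each point
    of a countable dense set by points of X0, at distances 1 / (n + 1).  Pairs
    (point of the countable set, n) are coded by integers. *)
Lemma dense_sequence_in (R : realType) (X : topologicalType) (x0 : X)
    (dist : X -> X -> R)
    (dist_tri : forall x y z, dist x z <= dist x y + dist y z)
    (dist_top : induces_topology dist) (X0 : set X) :
    separable X -> dense X0 ->
  exists y : nat -> X, (forall l, X0 (y l)) /\
    (forall U, open U -> U !=set0 -> exists l, U (y l)).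
Proof.
move=> [D D_countable dD] dX0.
have [D0|[d]] := pfcard_geP D_countable.
  by have [z] := dense_nbhs dD (filterT : nbhs x0 setT); rewrite D0.
have ball_nbhs x (r : R) : 0 < r -> nbhs x [set z | dist x z < r].
  by move=> r_gt0; rewrite dist_top; exists r.
have near_d (q : nat * nat) :
    exists z, X0 z /\ dist (d q.1) z < q.2.+1%:R^-1.
  have r_gt0 : 0 < q.2.+1%:R^-1 :> R by rewrite invr_gt0 ltr0n.
  have [z Xz dz] := dense_nbhs dX0 (ball_nbhs (d q.1) _ r_gt0).
  by exists z.
have [y Hy] := choice near_d.
exists (fun l => y (odflt (0, 0)%N (choice.unpickle l))); split.
  by move=> l; have [] := Hy (odflt (0, 0)%N (choice.unpickle l)).
move=> U oU [a Ua].
have := open_nbhs_nbhs (conj oU Ua); rewrite dist_top => -[r /= r_gt0 rU].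
pose k := Num.truncn (r / 2)^-1.
have k_lt : k.+1%:R^-1 < r / 2.
  rewrite -[ltRHS]invrK ltf_pV2 ?posrE ?invr_gt0 ?divr_gt0 ?ltr0n //.
  exact: truncnS_gt.
have r2_gt0 : 0 < r / 2 by rewrite divr_gt0.
have [w Dw aw] := dense_nbhs dD (ball_nbhs a _ r2_gt0).
have [i _ di] : (d @` setT) w by exact: 'surj_d.
exists (choice.pickle (i, k)); rewrite choice.pickleK /=; apply: rU => /=.
have [_ /= dy] := Hy (i, k); rewrite di in dy.
apply: le_lt_trans (dist_tri _ w _) _; rewrite (splitr r).
by rewrite ltrD // (lt_trans dy).
Qed.

(** * The frequent hypercyclicity criterion *)

Theorem theorem3p4 (R : realType) (rho : R -> R) (hrho : calibration rho)
    (u := calib_seq rho)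
    (K : numFieldType) (hK : real_or_complex R K)
    (X : tvsType K) (hX : frechet R X) (hsep : separable X)
    (hdim : infinite_dimensional X)
    (nrm : X -> R) (hnrm : Fnorm nrm)
    (htop : induces_topology (fun x y => nrm (x - y)))
    (T : {linear X -> X}) (hT : continuous T)
    (X0 : set X) (hX0 : dense X0) (S : X -> X) (hS : set_fun X0 X0 S)
    (h1 : forall x, X0 x ->
       unconditional_cvg_uniformly nrm [set k | (1 <= k)%N]
         (fun k j => if (j <= k)%N then iter (u k - u (k - j))%N T x else 0))
    (h2 : forall x, X0 x ->
       unconditional_cvg_uniformly nrm [set k | (1 <= k)%N]
         (fun k j => iter (u (j + k) - u k)%N S x))
    (h3 : forall x, X0 x -> T (S x) = x) :
  freq_hypercyclic rho T.
Proof.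
have dist_tri x y z : nrm (x - z) <= nrm (x - y) + nrm (y - z).
  by rewrite -(subrKA y x); exact: (Fnorm_triangle hnrm).
have u_lt : {homo u : i j / (i < j)%N} by move=> i j; exact: calib_seq_lt.
have u_le i j : (i <= j)%N -> (u i <= u j)%N.
  by rewrite leq_eqVlt => /predU1P[->//|/u_lt/ltnW].
have [y [yX0 y_dense]] := dense_sequence_in 0 dist_tri htop hsep hX0.
pose f l := shifted_term T S u (y l).
have f_tails l (e : R) : 0 < e -> exists N, uniformly_small_tails nrm (f l) e N.
  exact: (shifted_term_tails hnrm u_lt (h1 _ (yX0 l)) (h2 _ (yX0 l))).
have pow_gt0 l : 0 < ((2 : R) ^+ l)^-1 ^+ 2.
  by rewrite exprn_gt0 // invr_gt0 exprn_gt0.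
have [N HN] := choice (fun l => f_tails l _ (pow_gt0 l)).
(* The allowance N 0 in the gaps compensates the one in the colouring. *)
have [c [Nc c_rec]] := slow_recurrent_coloring N.
have [p [p0 p_gap [C p_le]]] := ruler_positions (N 0%N).
pose col i := c (logn 2 i).
have p_lt : {homo p : i j / (i < j)%N}.
  by move=> i j /p_gap; apply: leq_ltn_trans; rewrite -addnA leq_addr.
have p_gtid i : (i < p i)%N.
  by elim: i => [|i IH]; rewrite ?p0 // (leq_ltn_trans IH) // p_lt.
have p_ge i : (p 0%N <= p i)%N by rewrite p0 (leq_ltn_trans _ (p_gtid i)).
have p_inj : injective p.
  by move=> i j pij; case: (ltngtP i j) => // /p_lt; rewrite pij ltnn.
have gap_p i j : i != j ->
    (maxn (logn 2 i) (logn 2 j) + N 0 < gap (p i) (p j))%N.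
  by rewrite /gap neq_ltn => /orP[] /p_gap; lia.
have gap_col i j : i != j -> (N (col j) < gap (p i) (p j))%N.
  by move=> /gap_p; have := Nc (logn 2 j); rewrite /col; lia.
(* As p 0 = 1, the i-th term is S^(u_(p i) - u_1) applied to the point of
   colour col i; position p 0 carries no term and serves as the origin. *)
pose a i := f (col i) (p 0) (p i).
pose x m := \sum_(1 <= i < m) a i.
have [z xz] : exists z : X, x @ \oo --> z.
  apply: (Fnorm_complete hX hnrm htop) => e e_gt0.
  have [M HM] := uniformly_small_tails_colored hnrm f_tails HN e_gt0.
  exists M.+1 => m n Mm mn.
  have -> : x n - x m = \sum_(m <= i < n) a i.
    rewrite /x (big_cat_nat (leq_ltn_trans (leq0n M) Mm) mn) /=.
    by rewrite addrAC subrr add0r.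
  apply: HM => //; rewrite ?p0 ?iota_uniq // => i; rewrite mem_index_iota => mi.
  rewrite -p0 gtn_max gap_col ?andbT; last by lia.
  by rewrite /gap p0; have := p_gtid i; lia.
pose t j := (u (p j) - u (p 0))%N.
(* T^(t j) moves the origin of the two-sided sum from p 0 to p j. *)
have tE j m : (0 < j < m)%N ->
    iter (t j) T (x m) - y (col j) =
    \sum_(i <- rem j (index_iota 1 m)) f (col i) (p j) (p i).
  move=> jm; rewrite iter_sum.
  rewrite (eq_bigr (fun i => f (col i) (p j) (p i))); last first.
    by move=> i _; apply: (iter_shifted_term hS h3); rewrite // u_le // p_ge.
  rewrite (big_rem j) ?mem_index_iota //= {1}/f shifted_term_id.
  by rewrite addrAC subrr add0r.
exists z => U oU U_neq0.
have [l Uyl] := y_dense U oU U_neq0.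
have := open_nbhs_nbhs (conj oU Uyl); rewrite htop => -[r /= r_gt0 rU].
have r2_gt0 : 0 < r / 2 by rewrite divr_gt0.
have [M HM] := uniformly_small_tails_colored hnrm f_tails HN r2_gt0.
(* Valuations above M isolate p j from every other position by more than M,
   as the estimate HM requires. *)
have [v Mv cv] := c_rec l M.
have return_t j : (0 < j)%N -> logn 2 j = v -> U (iter (t j) T z).
  move=> j_gt0 jv; apply: rU => /=.
  have Tt_cont : continuous (iter (t j) T).
    elim: (t j) => [|n IH]; first by move=> w; exact: cvg_id.
    by move=> w; apply: (continuous_comp (IH w)); exact: hT.
  have : nbhs (iter (t j) T z) [set w | nrm (iter (t j) T z - w) < r / 2].
    by rewrite htop; exists (r / 2).
  move=> /(continuous_cvg _ (Tt_cont z) xz)[m0 _ Hm0].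
  pose m := maxn m0 j.+1.
  rewrite -(subrKA (iter (t j) T (x m))) (splitr r).
  apply: le_lt_trans (Fnorm_triangle hnrm _ _) (ltrD _ _); last first.
    by rewrite -(FnormN hnrm) opprB; apply: Hm0; rewrite /= leq_maxl.
  rewrite -(FnormN hnrm) opprB -cv -jv tE; last by rewrite j_gt0 leq_maxr.
  apply: HM => //; first exact: leq_ltn_trans (p_gtid j).
    by rewrite rem_uniq ?iota_uniq.
  move=> i; rewrite mem_rem_uniq ?iota_uniq // inE eq_sym => /andP[ji _].
  by rewrite gtn_max gap_col // andbT; have := gap_p _ _ ji; lia.
(* The numbers of 2-adic valuation v. *)
pose q j := (2 ^ v * j.*2.+1)%N.
have q_gt0 j : (0 < q j)%N by rewrite muln_gt0 expn_gt0.
have q_lt i j : (i < j)%N -> (q i < q j)%N.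
  by move=> ij; rewrite ltn_pmul2l ?expn_gt0 // ltnS ltn_double.
have q_logn j : logn 2 (q j) = v.
  by rewrite /q lognM ?expn_gt0 // pfactorK // lognE dvdn2 /= odd_double addn0.
have t_lt i j : (i < j)%N -> (t (q i) < t (q j))%N.
  move=> /q_lt/p_lt/u_lt; have := u_lt _ _ (p_lt _ _ (q_gt0 i)).
  by rewrite /t; lia.
apply: (@lower_density_gt0 _ _ hrho _ (t \o q) (C * 2 ^ v.+1)).
- by move=> i j /= tij; case: (ltngtP i j) => // /t_lt; rewrite tij ltnn.
- by move=> j; rewrite subn_gt0 u_lt // p_lt.
- by move=> j; apply: return_t.
- move=> j; apply: le_trans (rho_calib_seq_le hrho (leq_subr _ _)) _.
  rewrite ler_nat (leq_trans (p_le _)) // -mulnA leq_mul2l; apply/orP; right.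
  by rewrite /q expnS; have := expn_gt0 2 v; nia.
Qed.
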